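(* If $X$ is a compact geodesic space, then $\bar{\pi}_1^{\mathcal{C}}(X)$ is a Hausdorff topological group, and its elements are in bijective correspondence with the connected components of $\pi_1^{\mathcal{C}}(X)$.
   Context: A geodesic space is a metric space in which any two points are joined by a curve whose length equals the distance between them. Let $X$ be a geodesic space with base point $*$ (immaterial up to isomorphism). For $\varepsilon>0$, an $\varepsilon$-chain is a finite sequence $\{x_0,\dots,x_n\}$ in $X$ with $d(x_{i-1},x_i)<\varepsilon$ for all $i$. A basic move adds or removes one point, keeping the endpoints fixed and keeping the result an $\varepsilon$-chain; two $\varepsilon$-chains are $\varepsilon$-homotopic if connected by finitely many basic moves. $\pi_\varepsilon(X)$ is the group, under concatenation, of $\varepsilon$-homotopy classes of $\varepsilon$-chains that start and end at $*$. A strong $\varepsilon$-chain along a path $\gamma:[a,b]\to X$ is an $\varepsilon$-chain $\{\gamma(t_0),\dots,\gamma(t_n)\}$ for a partition $a=t_0<\dots<t_n=b$ with $\gamma([t_{i-1},t_i])\subset B_\varepsilon(\gamma(t_{i-1}))\cap B_\varepsilon(\gamma(t_i))$ for each $i$. The well-defined surjective homomorphism $h_\varepsilon:\pi_1(X)\to\pi_\varepsilon(X)$ sends $[\gamma]$ to the class of any strong $\varepsilon$-chain along $\gamma$. Put $K_\varepsilon=\ker h_\varepsilon$ (nested: $K_\delta\subseteq K_\varepsilon$ for $\delta<\varepsilon$) and $\pi_{cl}(X)=\bigcap_{\varepsilon>0}K_\varepsilon$. $\pi_1^{\mathcal{C}}(X)$ is $\pi_1(X)$ with the covering topology, i.e.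 the topology having as basis all cosets $gK_\varepsilon$, $g\in\pi_1(X)$, $\varepsilon>0$. $\bar{\pi}_1^{\mathcal{C}}(X)=\pi_1^{\mathcal{C}}(X)/\pi_{cl}(X)$ with the quotient topology. *)

(* Defs.v *)
From HB Require Import structures.
From mathcomp Require Import all_boot all_order all_algebra.
From mathcomp Require Import all_classical reals constructive_ereal ereal.
From mathcomp Require Import interval_inference topology normedtype numfun.
From mathcomp Require Import ring lra zify.
From Stdlib Require Import Relation_Operators.

Set Implicit Arguments.
Unset Strict Implicit.
Unset Printing Implicit Defensive.
Import Order.TTheory GRing.Theory Num.Theory.
Import numFieldNormedType.Exports.
Local Open Scope classical_set_scope.
Local Open Scope ring_scope.

Section geodesic.
Context {R : realType} (X : metricType R).

(* As in [itv_partition], [s] lists the points [t_1 < ... < t_n = c] of a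
   partition whose initial point [t_0 = a] is given separately. *)
Definition curve_variation (a : R) (f : R -> X) (s : seq R) : R :=
  \sum_(i < size s) mdist (f (nth 0 (a :: s) i)) (f (nth 0 (a :: s) i.+1)).

Definition curve_length (a c : R) (f : R -> X) : \bar R :=
  ereal_sup [set (curve_variation a f s)%:E | s in itv_partition a c].

Definition geodesic :=
  forall x y : X, exists f : R -> X,
    [/\ {within `[0, 1], continuous f}, f 0 = x, f 1 = y &
        curve_length 0 1 f = (mdist x y)%:E].

End geodesic.

Section within_continuity.

Lemma within_continuous_comp (S T U : topologicalType) (A : set S) (B : set T)
    (f : T -> U) (g : S -> T) :
  {within B, continuous f} -> {within A, continuous g} ->
  (forall x, A x -> B (g x)) -> {within A, continuous (f \o g)}.
Proof.
move=> /subspace_continuousP cf /subspace_continuousP cg AB.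
apply/subspace_continuousP => x Ax W /(cf _ (AB x Ax)) BW.
have := cg x Ax _ BW; rewrite !nbhs_simpl /within /= => H.
by apply: filterS H => y Wy Ay; apply: Wy => //; exact: AB.
Qed.

Lemma within_continuous_eq (S T : topologicalType) (A : set S) (f g : S -> T) :
  (forall x, A x -> f x = g x) ->
  {within A, continuous f} -> {within A, continuous g}.
Proof. by move=> fg; apply: subspace_eq_continuous => x /set_mem; exact: fg. Qed.

Lemma continuous_pair (S T U : topologicalType) (f : S -> T) (g : S -> U) :
  continuous f -> continuous g -> continuous (fun x => (f x, g x)).
Proof. by move=> cf cg x; apply: (cvg_pair (cf x) (cg x)). Qed.

Context {R : realType}.

Lemma within_continuous_if (T U : topologicalType) (C : set T) (r : T -> R)
    (f g : T -> U) :
  closed C -> continuous r ->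
  {within C `&` [set x | r x <= 2^-1], continuous f} ->
  {within C `&` [set x | 2^-1 <= r x], continuous g} ->
  (forall x, C x -> r x = 2^-1 -> f x = g x) ->
  {within C, continuous (fun x => if r x <= 2^-1 then f x else g x)}.
Proof.
move=> cC cr cf cg fg.
have cr' (D : set R) : closed D -> closed (C `&` r @^-1` D).
  by move=> cD; apply: closedI => //; apply: preimage_closed => // x _; exact: cr.
have CU : C `<=` (C `&` [set x | r x <= 2^-1]) `|` (C `&` [set x | 2^-1 <= r x]).
  by move=> x Cx; case: (lerP (r x) 2^-1) => [|/ltW] h; [left|right].
apply: (continuous_subspaceW CU); apply: withinU_continuous.
- exact: cr' (@closed_le R 2^-1).
- exact: cr' (@closed_ge R 2^-1).
- by apply: within_continuous_eq cf => x [_ /= ->].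
- apply: within_continuous_eq cg => x [Cx /= rx].
  by case: ifPn => // rx'; rewrite fg//; lra.
Qed.

Lemma uniform_continuity (T : pseudoMetricType R) (X : metricType R) (K : set T)
    (f : T -> X) (e : R) :
  compact K -> {within K, continuous f} -> 0 < e ->
  exists2 d : R, 0 < d &
    forall x y, K x -> K y -> ball x d y -> mdist (f x) (f y) < e.
Proof.
move=> /compact_near_coveringP/near_covering_withinP cK /subspace_continuousP cf e0.
pose P (d : R) x := forall y, K y -> ball x d y -> mdist (f x) (f y) < e.
have KP : \forall d \near 0^'+, K `<=` P d.
  apply: cK => x Kx.
  have e20 : 0 < e / 2 by rewrite divr_gt0.
  have := cf x Kx _ (nbhsx_ballx (f x) _ e20).
  rewrite nbhs_simpl /within /= => /nbhs_ballP[r /= r0 rK].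
  have r20 : 0 < r / 2 by rewrite divr_gt0.
  exists (ball x (r / 2), [set d | d < r / 2]).
    by split; [exact: nbhsx_ballx | exact: nbhs_right_lt].
  move=> -[x' d] /= [xx' dr] Kx' y Ky x'y.
  have xr : ball x r x' by apply: le_ball xx'; lra.
  have xy : ball x r y.
    rewrite (splitr r); apply: ball_triangle xx' _.
    by apply: le_ball x'y; exact: ltW.
  have := rK _ xr Kx'; have := rK _ xy Ky.
  rewrite !ballEmdist /= => fxy fxx'.
  have := metric_triangle (f x') (f x) (f y).
  rewrite (metric_sym (f x') (f x)) => /le_lt_trans; apply.
  by rewrite [ltRHS]splitr; exact: ltrD.
have [d [Kd d0]] := @filter_ex _ _ (at_right_proper_filter 0) _
  (filterI KP (nbhs_right_gt 0)).
by exists d => // x y Kx; exact: Kd.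
Qed.

End within_continuity.

Section fundamental_group.
Context {R : realType} {X : metricType R}.

(* Only the values on [0, 1] matter: [homotopic] below ignores the others. *)
Record loop (b : X) := Loop {
  loop_fun :> R -> X;
  loop_continuous : {within `[0, 1], continuous loop_fun};
  loop0 : loop_fun 0 = b;
  loop1 : loop_fun 1 = b }.
Arguments loop_continuous {b} _.

HB.instance Definition _ b := gen_eqMixin (loop b).
HB.instance Definition _ b := gen_choiceMixin (loop b).

Definition unit_square : set (R * R) := `[0, 1] `*` `[0, 1].

Definition path_homotopy (b : X) (f g : R -> X) (H : R * R -> X) :=
  [/\ {within unit_square, continuous H},
      (forall t : R, 0 <= t <= 1 -> H (0, t) = f t),
      (forall t : R, 0 <= t <= 1 -> H (1, t) = g t) &
      (forall s : R, 0 <= s <= 1 -> H (s, 0) = b /\ H (s, 1) = b)].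

Definition homotopic (b : X) (f g : loop b) : bool :=
  `[< exists H, path_homotopy b f g H >].

Context {b : X}.
Implicit Types f g h : loop b.

Lemma unit_squareE s t : unit_square (s, t) = (0 <= s <= 1 /\ 0 <= t <= 1) :> Prop.
Proof. by rewrite /unit_square /= !in_itv. Qed.

Lemma closed_unit_square : closed unit_square.
Proof.
rewrite [unit_square](_ : _ = fst @^-1` `[0, 1] `&` snd @^-1` `[0, 1]) //.
apply: closedI; apply: preimage_closed; try exact: itv_closed.
- by move=> x _; exact: cvg_fst.
- by move=> x _; exact: cvg_snd.
Qed.

Lemma compact_unit_square : compact unit_square.
Proof. by apply: compact_setX; exact: segment_compact. Qed.

Lemma homotopic_refl : reflexive (@homotopic b).
Proof.
move=> f; apply/asboolP; exists (f \o snd); split => //=.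
- apply: (within_continuous_comp (loop_continuous f)) => [|[x y] []//].
  by apply: continuous_subspaceT => x; exact: cvg_snd.
- by move=> s _; rewrite loop0 loop1.
Qed.

Lemma homotopic_sym : symmetric (@homotopic b).
Proof.
suff H f g : homotopic f g -> homotopic g f by move=> f g; apply/idP/idP; exact: H.
move=> /asboolP[H [cH H0 H1 Hs]]; apply/asboolP.
exists (H \o (fun p : R * R => (1 - p.1, p.2))); split => /=.
- apply: (within_continuous_comp cH).
    apply: continuous_subspaceT; apply: continuous_pair => x; last exact: cvg_snd.
    by apply: cvgB; [exact: cvg_cst | exact: cvg_fst].
  by move=> -[s t]; rewrite !unit_squareE /=; lra.
- by move=> t t01; rewrite subr0 H1.
- by move=> t t01; rewrite subrr H0.
- by move=> s s01; apply: Hs; lra.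
Qed.

Lemma homotopic_trans : transitive (@homotopic b).
Proof.
move=> g f h /asboolP[H [cH H0 H1 Hs]] /asboolP[K [cK K0 K1 Ks]].
apply/asboolP; exists (fun p => if p.1 <= 2^-1 then H (2 * p.1, p.2)
                                else K (2 * p.1 - 1, p.2)); split => /=.
- apply: within_continuous_if; first exact: closed_unit_square.
  + by move=> x; exact: cvg_fst.
  + apply: (@within_continuous_comp _ _ _ _ unit_square H
      (fun p : R * R => (2 * p.1, p.2)) cH) => [|[s t] []].
      apply: continuous_subspaceT; apply: continuous_pair => x; last exact: cvg_snd.
      by apply: cvgM; [exact: cvg_cst | exact: cvg_fst].
    by move: (s : R) (t : R) => {}s {}t; rewrite !unit_squareE /=; lra.
  + apply: (@within_continuous_comp _ _ _ _ unit_square K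
      (fun p : R * R => (2 * p.1 - 1, p.2)) cK) => [|[s t] []].
      apply: continuous_subspaceT; apply: continuous_pair => x; last exact: cvg_snd.
      apply: cvgB; last exact: cvg_cst.
      by apply: cvgM; [exact: cvg_cst | exact: cvg_fst].
    by move: (s : R) (t : R) => {}s {}t; rewrite !unit_squareE /=; lra.
  + move=> [s t]; rewrite unit_squareE /= => -[_ t01] ->.
    by rewrite divff// subrr H1// K0.
- by move=> t t01; rewrite invr_ge0 ler0n mulr0 H0.
- by move=> t t01; rewrite ifN ?mulr1; [rewrite [_ - 1](_ : _ = 1) ?K1//; lra | lra].
- move=> s s01; case: ifPn => s2; [apply: Hs | apply: Ks]; lra.
Qed.

Canonical homotopic_equiv :=
  EquivRel (@homotopic b) homotopic_refl homotopic_sym homotopic_trans.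

Lemma loop_reparametrization f g h (phi psi : R -> R) :
  continuous phi -> continuous psi ->
  (forall t : R, 0 <= t <= 1 ->
    [/\ 0 <= phi t <= 1, 0 <= psi t <= 1, g t = f (phi t) & h t = f (psi t)]) ->
  phi 0 = psi 0 -> phi 1 = psi 1 -> homotopic g h.
Proof.
move=> cphi cpsi pp p0 p1; apply/asboolP.
exists (f \o (fun p : R * R => phi p.2 + p.1 * (psi p.2 - phi p.2))); split => /=.
- apply: (within_continuous_comp (loop_continuous f)) => [|[s t]].
    apply: continuous_subspaceT => x.
    have c2 (k : R -> R) : continuous k -> k p.2 @[p --> x] --> k x.2.
      move=> ck; apply: (@cvg_comp _ _ _ snd k _ (nbhs x.2)); last exact: ck.
      exact: cvg_snd.
    apply: cvgD; first exact: c2.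
    by apply: cvgM; [exact: cvg_fst | apply: cvgB; exact: c2].
  rewrite unit_squareE /= in_itv /= => -[s01 t01].
  by have [? ? _ _] := pp t t01; apply/andP; split; nra.
- by move=> t t01; have [_ _ -> _] := pp t t01; rewrite mul0r addr0.
- by move=> t t01; have [_ _ _ ->] := pp t t01; rewrite mul1r addrC subrK.
- move=> s s01; rewrite p0 p1 !subrr !mulr0 !addr0 -p0 -p1.
  have [_ _ <- _] : [/\ 0 <= phi 0 <= 1, 0 <= psi 0 <= 1,
      g 0 = f (phi 0) & h 0 = f (psi 0)].
    by apply: pp; lra.
  have [_ _ <- _] : [/\ 0 <= phi 1 <= 1, 0 <= psi 1 <= 1,
      g 1 = f (phi 1) & h 1 = f (psi 1)].
    by apply: pp; lra.
  by rewrite loop0 loop1.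
Qed.


Lemma affine_continuous (c d : R) : continuous (fun t : R => c * t + d).
Proof.
move=> x; apply: cvgD; last exact: cvg_cst.
by apply: cvgM; [exact: cvg_cst | exact: cvg_id].
Qed.

Section concatenation.
Variables f g : loop b.

Definition concat (t : R) : X :=
  if t <= 2^-1 then f (2 * t) else g (2 * t - 1).

Lemma concat_continuous : {within `[0, 1], continuous concat}.
Proof.
apply: within_continuous_if => //=.
- exact: itv_closed.
- by move=> x; exact: cvg_id.
- apply: (@within_continuous_comp _ _ _ _ _ f (fun t : R => 2 * t)
    (loop_continuous f)) => [|t []] /=.
    apply: continuous_subspaceT => x.
    by apply: cvgM; [exact: cvg_cst | exact: cvg_id].
  by rewrite !in_itv /=; lra.
- apply: (@within_continuous_comp _ _ _ _ _ g (fun t : R => 2 * t - 1)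
    (loop_continuous g)) => [|t []] /=.
    by apply: continuous_subspaceT; exact: affine_continuous.
  by rewrite !in_itv /=; lra.
- by move=> t _ ->; rewrite divff// subrr loop0 loop1.
Qed.

Lemma concat0 : concat 0 = b.
Proof. by rewrite /concat invr_ge0 ler0n mulr0 loop0. Qed.

Lemma concat1 : concat 1 = b.
Proof.
rewrite /concat ifN; last by lra.
by rewrite [_ - 1](_ : _ = 1) ?loop1//; lra.
Qed.

Definition loop_concat := Loop concat_continuous concat0 concat1.

End concatenation.

Section reversal.
Variable f : loop b.

Lemma reverse_continuous : {within `[0, 1], continuous (fun t => f (1 - t))}.
Proof.
apply: (@within_continuous_comp _ _ _ _ _ f (fun t : R => 1 - t)
  (loop_continuous f)) => [|t] /=.
  by apply: continuous_subspaceT => x; apply: cvgB; [exact: cvg_cst | exact: cvg_id].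
by rewrite !in_itv /=; lra.
Qed.

Lemma reverse0 : f (1 - 0) = b. Proof. by rewrite subr0 loop1. Qed.
Lemma reverse1 : f (1 - 1) = b. Proof. by rewrite subrr loop0. Qed.

Definition loop_reverse :=
  @Loop b (fun t => f (1 - t)) reverse_continuous reverse0 reverse1.

End reversal.

Lemma constant_continuous : {within `[0, 1], continuous (fun _ : R => b)}.
Proof. by apply: continuous_subspaceT => x; exact: cvg_cst. Qed.

Definition loop_const : loop b :=
  @Loop b (fun=> b) constant_continuous erefl erefl.

Lemma homotopic_concat f f' g g' : homotopic f f' -> homotopic g g' ->
  homotopic (loop_concat f g) (loop_concat f' g').
Proof.
move=> /asboolP[H [cH H0 H1 Hs]] /asboolP[K [cK K0 K1 Ks]].
apply/asboolP; exists (fun p => if p.2 <= 2^-1 then H (p.1, 2 * p.2)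
                                else K (p.1, 2 * p.2 - 1)); split => /=.
- apply: within_continuous_if; first exact: closed_unit_square.
  + by move=> x; exact: cvg_snd.
  + apply: (@within_continuous_comp _ _ _ _ unit_square H
      (fun p : R * R => (p.1, 2 * p.2)) cH) => [|[s t] []].
      apply: continuous_subspaceT; apply: continuous_pair => x; first exact: cvg_fst.
      by apply: cvgM; [exact: cvg_cst | exact: cvg_snd].
    by move: (s : R) (t : R) => {}s {}t; rewrite !unit_squareE /=; lra.
  + apply: (@within_continuous_comp _ _ _ _ unit_square K
      (fun p : R * R => (p.1, 2 * p.2 - 1)) cK) => [|[s t] []].
      apply: continuous_subspaceT; apply: continuous_pair => x; first exact: cvg_fst.
      apply: cvgB; last exact: cvg_cst.
      by apply: cvgM; [exact: cvg_cst | exact: cvg_snd].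
    by move: (s : R) (t : R) => {}s {}t; rewrite !unit_squareE /=; lra.
  + move=> [s t]; rewrite unit_squareE /= => -[s01 _] ->.
    by rewrite divff// subrr (Hs s s01).2 (Ks s s01).1.
- move=> t t01; rewrite /concat; case: ifPn => t2; [apply: H0 | apply: K0]; lra.
- move=> t t01; rewrite /concat; case: ifPn => t2; [apply: H1 | apply: K1]; lra.
- move=> s s01; rewrite invr_ge0 ler0n mulr0 (Hs s s01).1; split => //.
  rewrite ifN; last by lra.
  by rewrite [_ - 1](_ : _ = 1) ?(Ks s s01).2//; lra.
Qed.

Lemma homotopic_reverse f g : homotopic f g ->
  homotopic (loop_reverse f) (loop_reverse g).
Proof.
move=> /asboolP[H [cH H0 H1 Hs]]; apply/asboolP.
exists (H \o (fun p : R * R => (p.1, 1 - p.2))); split => /=.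
- apply: (within_continuous_comp cH).
    apply: continuous_subspaceT; apply: continuous_pair => x; first exact: cvg_fst.
    by apply: cvgB; [exact: cvg_cst | exact: cvg_snd].
  by move=> -[s t]; rewrite !unit_squareE /=; lra.
- by move=> t t01; rewrite H0//; lra.
- by move=> t t01; rewrite H1//; lra.
- by move=> s s01; rewrite subr0 subrr (Hs s s01).1 (Hs s s01).2.
Qed.

Lemma homotopic_concatA f g h :
  homotopic (loop_concat f (loop_concat g h)) (loop_concat (loop_concat f g) h).
Proof.
rewrite homotopic_sym.
pose phi : R -> R := (fun t : R => 2 * t + 0) \min
  ((fun t : R => 1 * t + 4^-1) \min (fun t : R => 2^-1 * t + 2^-1)).
have phi1 t : t <= 4^-1 -> phi t = 2 * t.
  by move=> t4; rewrite /phi /= !min_l//; lra.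
have phi2 t : 4^-1 <= t -> t <= 2^-1 -> phi t = t + 4^-1.
  by move=> t4 t2; rewrite /phi /= min_r ?min_l//; lra.
have phi3 t : 2^-1 <= t -> phi t = 2^-1 * t + 2^-1.
  by move=> t2; rewrite /phi /= !min_r//; lra.
have cphi : continuous phi.
  move=> t; apply: continuous_min; first exact: affine_continuous.
  by apply: continuous_min; exact: affine_continuous.
apply: (@loop_reparametrization (loop_concat f (loop_concat g h)) _ _ phi idfun) => //.
- by move=> x; exact: cvg_id.
- move=> t t01; rewrite /= /concat /=.
  have [t4|t4] := lerP t 4^-1.
    rewrite phi1//; split => //; [lra|].
    by rewrite ifT ?ifT /concat ?ifT//; lra.
  have [t2|t2] := lerP t 2^-1.
    rewrite phi2 ?(ltW t4)//; split => //; [lra|].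
    rewrite /concat ifN; last by lra.
    rewrite ifN; last by lra.
    rewrite ifT; last by lra.
    by congr (g _); lra.
  rewrite phi3 ?(ltW t2)//; split => //; [lra|].
  rewrite /concat ifN; last by lra.
  rewrite ifN; last by lra.
  by congr (h _); lra.
- by rewrite phi1 ?mulr0//; lra.
- by rewrite phi3 /=; lra.
Qed.

Lemma homotopic_const_concat f : homotopic (loop_concat loop_const f) f.
Proof.
pose phi : R -> R := (fun t : R => 2 * t + -1) \max (fun t : R => 0 * t + 0).
have phi1 t : t <= 2^-1 -> phi t = 0.
  by move=> t2; rewrite /phi /= max_r; lra.
have phi2 t : 2^-1 <= t -> phi t = 2 * t - 1.
  by move=> t2; rewrite /phi /= max_l; lra.
have cphi : continuous phi by move=> t; apply: continuous_max; exact: affine_continuous.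
apply: (@loop_reparametrization f _ _ phi idfun) => //.
- by move=> x; exact: cvg_id.
- move=> t t01; rewrite /= /concat /=; have [t2|t2] := lerP t 2^-1.
    by rewrite phi1// loop0; split => //; lra.
  by rewrite phi2 ?(ltW t2)//; split => //; lra.
- by rewrite phi1//; lra.
- by rewrite phi2 /=; lra.
Qed.

Lemma homotopic_concat_const f : homotopic (loop_concat f loop_const) f.
Proof.
pose phi : R -> R := (fun t : R => 2 * t + 0) \min (fun t : R => 0 * t + 1).
have phi1 t : t <= 2^-1 -> phi t = 2 * t.
  by move=> t2; rewrite /phi /= min_l; lra.
have phi2 t : 2^-1 <= t -> phi t = 1.
  by move=> t2; rewrite /phi /= min_r; lra.
have cphi : continuous phi by move=> t; apply: continuous_min; exact: affine_continuous.
apply: (@loop_reparametrization f _ _ phi idfun) => //.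
- by move=> x; exact: cvg_id.
- move=> t t01; rewrite /= /concat /=; have [t2|t2] := lerP t 2^-1.
    by rewrite phi1//; split => //; lra.
  by rewrite phi2 ?(ltW t2)// loop1; split => //; lra.
- by rewrite phi1 ?mulr0//; lra.
- by rewrite phi2 /=; lra.
Qed.

Lemma homotopic_concat_reverse f :
  homotopic (loop_concat f (loop_reverse f)) loop_const.
Proof.
pose phi : R -> R := (fun t : R => 2 * t + 0) \min (fun t : R => - 2 * t + 2).
have phi1 t : t <= 2^-1 -> phi t = 2 * t.
  by move=> t2; rewrite /phi /= min_l; lra.
have phi2 t : 2^-1 <= t -> phi t = - 2 * t + 2.
  by move=> t2; rewrite /phi /= min_r; lra.
have cphi : continuous phi by move=> t; apply: continuous_min; exact: affine_continuous.
apply: (@loop_reparametrization f _ _ phi (fun=> 0)) => //.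
- by move=> x; exact: cvg_cst.
- move=> t t01; rewrite /= /concat /= loop0; have [t2|t2] := lerP t 2^-1.
    by rewrite phi1//; split => //; lra.
  rewrite phi2 ?(ltW t2)//; split => //; [lra|lra|].
  by congr (f _); lra.
- by rewrite phi1 ?mulr0//; lra.
- by rewrite phi2 /=; lra.
Qed.

Lemma homotopic_reverse_concat f :
  homotopic (loop_concat (loop_reverse f) f) loop_const.
Proof.
pose phi : R -> R := (fun t : R => - 2 * t + 1) \max (fun t : R => 2 * t + -1).
have phi1 t : t <= 2^-1 -> phi t = - 2 * t + 1.
  by move=> t2; rewrite /phi /= max_l; lra.
have phi2 t : 2^-1 <= t -> phi t = 2 * t - 1.
  by move=> t2; rewrite /phi /= max_r; lra.
have cphi : continuous phi by move=> t; apply: continuous_max; exact: affine_continuous.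
apply: (@loop_reparametrization f _ _ phi (fun=> 1)) => //.
- by move=> x; exact: cvg_cst.
- move=> t t01; rewrite /= /concat /= loop1; have [t2|t2] := lerP t 2^-1.
    rewrite phi1//; split => //; [lra|lra|].
    by congr (f _); lra.
  by rewrite phi2 ?(ltW t2)//; split => //; lra.
- by rewrite phi1; lra.
- by rewrite phi2 /=; lra.
Qed.

Local Open Scope quotient_scope.

Definition pi1 := {eq_quot homotopic_equiv}.
HB.instance Definition _ := EqQuotient.on pi1.
HB.instance Definition _ := Choice.on pi1.

Definition pi1_one : pi1 := \pi_pi1 loop_const.
Definition pi1_mul (p q : pi1) : pi1 := \pi_pi1 (loop_concat (repr p) (repr q)).
Definition pi1_inv (p : pi1) : pi1 := \pi_pi1 (loop_reverse (repr p)).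

Lemma pi1P f g : \pi_pi1 f = \pi_pi1 g <-> homotopic f g.
Proof. by split=> [/eqmodP|H]; last exact/eqmodP. Qed.

Lemma pi1_mulE f g : pi1_mul (\pi f) (\pi g) = \pi_pi1 (loop_concat f g).
Proof. by apply/pi1P/homotopic_concat; apply/pi1P; rewrite reprK. Qed.

Lemma pi1_invE f : pi1_inv (\pi f) = \pi_pi1 (loop_reverse f).
Proof. by apply/pi1P/homotopic_reverse; apply/pi1P; rewrite reprK. Qed.

Lemma pi1_mulA : associative pi1_mul.
Proof.
elim/quotW=> f; elim/quotW=> g; elim/quotW=> h.
by rewrite !pi1_mulE; apply/pi1P/homotopic_concatA.
Qed.

Lemma pi1_mul1 : left_id pi1_one pi1_mul.
Proof. by elim/quotW=> f; rewrite pi1_mulE; apply/pi1P/homotopic_const_concat. Qed.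

Lemma pi1_1mul : right_id pi1_one pi1_mul.
Proof. by elim/quotW=> f; rewrite pi1_mulE; apply/pi1P/homotopic_concat_const. Qed.

Lemma pi1_mulV : left_inverse pi1_one pi1_inv pi1_mul.
Proof.
elim/quotW=> f; rewrite pi1_invE pi1_mulE.
by apply/pi1P/homotopic_reverse_concat.
Qed.

Lemma pi1_Vmul : right_inverse pi1_one pi1_inv pi1_mul.
Proof.
elim/quotW=> f; rewrite pi1_invE pi1_mulE.
by apply/pi1P/homotopic_concat_reverse.
Qed.

HB.instance Definition _ := isGroup.Build pi1
  pi1_mulA pi1_mul1 pi1_1mul pi1_mulV pi1_Vmul.

End fundamental_group.
Arguments pi1 {R X} b.
Arguments loop_continuous {R X b} _.

Section epsilon_group.
Context {R : realType} {X : metricType R}.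
Implicit Types (e : R) (x y z : X) (s w : seq X).

Definition eps_close e x y := mdist x y < e.

(* The chain {x_0, ..., x_n} from [x] to [y] is represented by its initial point
   [x = x_0] and by the sequence [s] of the points x_1, ..., x_n. *)
Definition echain e x y s := path (eps_close e) x s && (last x s == y).

(* The initial point is not part of [s] and the final one is fixed by [echain],
   so [z] can go anywhere: a copy of the initial point inserted in front of the
   chain or right after it gives the same chain. *)
Definition add_point s w := exists u v z, s = u ++ v /\ w = u ++ z :: v.

Definition basic_move e x y s w :=
  [/\ echain e x y s, echain e x y w & add_point s w \/ add_point w s].

Definition ehomotopic e x y : seq X -> seq X -> Prop :=
  clos_refl_trans (seq X) (basic_move e x y).

Lemma ehomotopic_refl e x y s : ehomotopic e x y s s.
Proof. exact: rt_refl. Qed.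

Lemma ehomotopic_trans e x y s2 s1 s3 :
  ehomotopic e x y s1 s2 -> ehomotopic e x y s2 s3 -> ehomotopic e x y s1 s3.
Proof. exact: rt_trans. Qed.

Lemma ehomotopic_sym e x y s w : ehomotopic e x y s w -> ehomotopic e x y w s.
Proof.
elim=> [s1 s2 [c1 c2 a]|s1|s1 s2 s3 _ h1 _ h2].
- by apply: rt_step; split => //; case: a; [right|left].
- exact: rt_refl.
- exact: rt_trans h2 h1.
Qed.

Lemma ehomotopic_map e1 x1 y1 e2 x2 y2 (F : seq X -> seq X) :
  (forall s, echain e1 x1 y1 s -> echain e2 x2 y2 (F s)) ->
  (forall s w, add_point s w -> add_point (F s) (F w)) ->
  forall s w, ehomotopic e1 x1 y1 s w -> ehomotopic e2 x2 y2 (F s) (F w).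
Proof.
move=> cF aF s w; elim=> [s1 s2 [c1 c2 a]|s1|s1 s2 s3 _ h1 _ h2].
- by apply: rt_step; split; [exact: cF|exact: cF|case: a => /aF; [left|right]].
- exact: rt_refl.
- exact: rt_trans h1 h2.
Qed.

Lemma eps_close_refl e x : 0 < e -> eps_close e x x.
Proof. by rewrite /eps_close mdistxx. Qed.

Lemma eps_close_sym e x y : eps_close e x y = eps_close e y x.
Proof. by rewrite /eps_close metric_sym. Qed.

Lemma echain_cat e x y z s w :
  echain e x y s -> echain e y z w -> echain e x z (s ++ w).
Proof.
by rewrite /echain cat_path last_cat => /andP[-> /eqP ->] /andP[-> ->].
Qed.

Lemma add_point_catl u s w : add_point s w -> add_point (u ++ s) (u ++ w).
Proof. by move=> [u' [v [z [-> ->]]]]; exists (u ++ u'), v, z; rewrite !catA. Qed.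

Lemma add_point_catr u s w : add_point s w -> add_point (s ++ u) (w ++ u).
Proof. by move=> [u' [v [z [-> ->]]]]; exists u', (v ++ u), z; rewrite -!catA. Qed.

Lemma ehomotopic_catl e x y z u s w : echain e x y u ->
  ehomotopic e y z s w -> ehomotopic e x z (u ++ s) (u ++ w).
Proof.
move=> cu; apply: ehomotopic_map => [s' cs'|]; last exact: add_point_catl.
exact: echain_cat cu cs'.
Qed.

Lemma ehomotopic_catr e x y z u s w : echain e y z u ->
  ehomotopic e x y s w -> ehomotopic e x z (s ++ u) (w ++ u).
Proof.
move=> cu; apply: (@ehomotopic_map _ _ _ _ _ _ (cat^~ u)) => [s' cs'|];
  last exact: add_point_catr.
exact: echain_cat cs' cu.
Qed.

Lemma ehomotopic_cons e x y z s w : eps_close e x y ->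
  ehomotopic e y z s w -> ehomotopic e x z (y :: s) (y :: w).
Proof.
move=> xy; apply: (@ehomotopic_catl e x y z [:: y]).
by rewrite /echain /= xy eqxx.
Qed.

Lemma ehomotopic_insert e x y u v z :
  echain e x y (u ++ v) -> echain e x y (u ++ z :: v) ->
  ehomotopic e x y (u ++ v) (u ++ z :: v).
Proof. by move=> h1 h2; apply: rt_step; split => //; left; exists u, v, z. Qed.

Lemma ehomotopic_le e1 e2 x y s w : e1 <= e2 ->
  ehomotopic e1 x y s w -> ehomotopic e2 x y s w.
Proof.
move=> e12; apply: (@ehomotopic_map e1 x y e2 x y id) => // s'.
rewrite /echain => /andP[cs' ->].
by rewrite andbT; apply: sub_path cs' => a b /lt_le_trans; exact.
Qed.

Variables (b : X) (e : R).

Record eloop := ELoop { eloop_seq :> seq X; _ : echain e b b eloop_seq }.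
HB.instance Definition _ := [isSub for eloop_seq].
HB.instance Definition _ := [Choice of eloop by <:].
Implicit Types c d : eloop.

Lemma eloopP c : echain e b b c. Proof. by case: c. Qed.

Definition eloop_homotopic c d : bool := `[< ehomotopic e b b c d >].

Lemma eloop_homotopic_refl : reflexive eloop_homotopic.
Proof. by move=> c; apply/asboolP; exact: ehomotopic_refl. Qed.

Lemma eloop_homotopic_sym : symmetric eloop_homotopic.
Proof.
by move=> c d; apply/idP/idP => /asboolP h; apply/asboolP; exact: ehomotopic_sym.
Qed.

Lemma eloop_homotopic_trans : transitive eloop_homotopic.
Proof.
move=> d c c' /asboolP h1 /asboolP h2; apply/asboolP.
exact: ehomotopic_trans h1 h2.
Qed.

Canonical eloop_homotopic_equiv := EquivRel eloop_homotopic
  eloop_homotopic_refl eloop_homotopic_sym eloop_homotopic_trans.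

Definition eloop_const : eloop := @ELoop [::] (eqxx b).
Definition eloop_cat c d : eloop := ELoop (echain_cat (eloopP c) (eloopP d)).

Lemma echain_rev x y s :
  echain e x y s -> echain e y x (rev (belast x s)).
Proof.
rewrite /echain => /andP[cs /eqP <-]; rewrite rev_path.
rewrite (eq_path (e' := eps_close e)) ?cs /=; last by move=> ? ?; rewrite eps_close_sym.
by case: s cs => //= z s _; rewrite rev_cons last_rcons.
Qed.

(* The whole chain is [b :: c], with final point [b]; reversing it and dropping
   the new initial point leaves [rev (belast b c)]. *)
Definition eloop_rev c : eloop := ELoop (echain_rev (eloopP c)).

Lemma ehomotopic_cancel x y s : echain e x y s ->
  ehomotopic e x x (s ++ rev (belast x s)) [::].
Proof.
elim: s x => [|z s IH] x /=; first by move=> _; exact: ehomotopic_refl.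
rewrite /echain /= => /andP[/andP[xz zs] yE].
have {}IH := IH z (introT andP (conj zs yE)).
rewrite rev_cons -rcons_cat -cats1.
apply: (@ehomotopic_trans _ _ _ [:: z; x]).
  apply: (ehomotopic_cons xz); apply: (ehomotopic_catr _ IH).
  by rewrite /echain /= eqxx eps_close_sym xz.
have e0 : 0 < e by rewrite (le_lt_trans (mdist_ge0 x z)).
apply: ehomotopic_sym; apply: (@ehomotopic_trans _ _ _ [:: x]).
  by apply: (@ehomotopic_insert _ _ _ [::] [::] x);
    rewrite /echain /= ?eps_close_refl ?eqxx.
by apply: (@ehomotopic_insert _ _ _ [::] [:: x] z);
  rewrite /echain /= ?eps_close_refl ?eqxx ?xz // eps_close_sym xz.
Qed.

Local Open Scope quotient_scope.

Definition pi_eps := {eq_quot eloop_homotopic_equiv}.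
HB.instance Definition _ := EqQuotient.on pi_eps.
HB.instance Definition _ := Choice.on pi_eps.

Definition pi_eps_one : pi_eps := \pi_pi_eps eloop_const.
Definition pi_eps_mul (p q : pi_eps) : pi_eps :=
  \pi_pi_eps (eloop_cat (repr p) (repr q)).
Definition pi_eps_inv (p : pi_eps) : pi_eps := \pi_pi_eps (eloop_rev (repr p)).

Lemma pi_epsP c d : \pi_pi_eps c = \pi_pi_eps d <-> ehomotopic e b b c d.
Proof. by split=> [/eqmodP/asboolP|H]; last exact/eqmodP/asboolP. Qed.

Lemma pi_eps_mulE c d : pi_eps_mul (\pi c) (\pi d) = \pi_pi_eps (eloop_cat c d).
Proof.
apply/pi_epsP => /=; apply: (@ehomotopic_trans _ _ _ (c ++ repr (\pi_pi_eps d))).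
- by apply: ehomotopic_catr (eloopP _) _; apply/pi_epsP; rewrite reprK.
- by apply: ehomotopic_catl (eloopP _) _; apply/pi_epsP; rewrite reprK.
Qed.

Lemma pi_eps_mulA : associative pi_eps_mul.
Proof.
elim/quotW=> c; elim/quotW=> c'; elim/quotW=> d; rewrite !pi_eps_mulE.
by apply/pi_epsP; rewrite /= catA; exact: ehomotopic_refl.
Qed.

Lemma pi_eps_mul1 : left_id pi_eps_one pi_eps_mul.
Proof.
by elim/quotW=> c; rewrite pi_eps_mulE; apply/pi_epsP; exact: ehomotopic_refl.
Qed.

Lemma pi_eps_1mul : right_id pi_eps_one pi_eps_mul.
Proof.
elim/quotW=> c; rewrite pi_eps_mulE; apply/pi_epsP; rewrite /= cats0.
exact: ehomotopic_refl.
Qed.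

Lemma pi_eps_mulV : right_inverse pi_eps_one pi_eps_inv pi_eps_mul.
Proof.
move=> p; rewrite -[X in pi_eps_mul X _]reprK pi_eps_mulE.
by apply/pi_epsP => /=; exact: ehomotopic_cancel (eloopP _).
Qed.

Lemma pi_eps_Vmul : left_inverse pi_eps_one pi_eps_inv pi_eps_mul.
Proof.
move=> p; set q := pi_eps_inv p; rewrite -[LHS]pi_eps_1mul -(pi_eps_mulV q).
have pq : pi_eps_mul p q = pi_eps_one by exact: pi_eps_mulV.
by rewrite pi_eps_mulA -(pi_eps_mulA q p q) pq pi_eps_1mul.
Qed.

HB.instance Definition _ := isGroup.Build pi_eps
  pi_eps_mulA pi_eps_mul1 pi_eps_1mul pi_eps_Vmul pi_eps_mulV.

End epsilon_group.

Section canonical_map.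
Context {R : realType} {X : metricType R}.
Implicit Types (e d : R) (s w l : seq R).

(* [s] lists t_1 < ... < t_n = 1; the initial point t_0 = 0 is omitted. *)
Definition strong_partition e (f : R -> X) s :=
  itv_partition 0 1 s /\
  forall i, (i < size s)%N ->
    f @` `[nth 0 (0 :: s) i, nth 0 (0 :: s) i.+1] `<=`
    ball (f (nth 0 (0 :: s) i)) e `&` ball (f (nth 0 (0 :: s) i.+1)) e.

Definition strong_step e (f : R -> X) a c : bool :=
  (a < c) &&
  `[< forall t, a <= t <= c -> eps_close e (f a) (f t) /\ eps_close e (f c) (f t) >].

Lemma strong_partitionP e f s : strong_partition e f s ->
  path (strong_step e f) 0 s /\ last 0 s = 1.
Proof.
move=> [[/(pathP 0) s_lt /eqP s1] sball]; split => //.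
apply/(pathP 0) => i si; rewrite /strong_step s_lt//=; apply/asboolP => t t01.
have /= := sball i si (f t); rewrite !ballEmdist /= => h.
by apply: h; exists t => //; rewrite in_itv.
Qed.

Definition short_step d : rel R := fun x y => (x <= y) && (y < x + d).

Lemma path_iota (T : Type) (r : rel T) (F : nat -> T) k n :
  (forall i, (k <= i < k + n)%N -> r (F i) (F i.+1)) ->
  path r (F k) (map F (iota k.+1 n)).
Proof.
elim: n k => //= n IH k H; rewrite H ?leqnn ?addnS ?ltnS ?leq_addr//=.
by apply: IH => i /andP[ki ik]; apply: H; rewrite (ltnW ki) addnS -addSn.
Qed.

Lemma last_iota (T : Type) (F : nat -> T) k n :
  last (F k) (map F (iota k.+1 n)) = F (k + n)%N.
Proof. by elim: n k => [|n IH] k /=; rewrite ?addn0// IH addnS. Qed.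

Lemma fine_bounds d a l : path (short_step d) a l ->
  forall t, t \in a :: l -> a <= t <= last a l.
Proof.
elim: l a => [|c l IH] a /=; first by move=> _ t; rewrite inE => /eqP ->; rewrite lexx.
move=> /andP[/andP[ac _] cl] t; rewrite inE => /orP[/eqP ->|/(IH _ cl)/andP[ct ->]].
  rewrite lexx (le_trans ac)//.
  by have /andP[] := IH _ cl c (mem_head _ _).
by rewrite (le_trans ac ct).
Qed.

Lemma inv_small d : 0 < d -> exists2 M : nat, (0 < M)%N &
  forall N : nat, (M <= N)%N -> (N%:R : R)^-1 < d.
Proof.
move=> d0; exists (Num.bound d^-1).+1 => // N MN.
have N0 : (0 < N)%N by apply: leq_trans MN.
rewrite -(invrK d) ltf_pV2 ?posrE ?invr_gt0 ?ltr0n//.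
have := @archi_boundP R d^-1; rewrite invr_ge0 ltW// => /(_ isT) /lt_trans; apply.
by rewrite ltr_nat.
Qed.

Lemma fine_subdivision d a c : 0 < d -> a < c ->
  exists l, [/\ path (short_step d) a l, last a l = c & l <> [::]].
Proof.
move=> d0 ac; have ca : 0 < c - a by rewrite subr_gt0.
have [N N0 /(_ _ (leqnn N)) Nd] := inv_small (divr_gt0 d0 ca).
have N0' : 0 < (N%:R : R) by rewrite ltr0n.
pose F k : R := a + (c - a) * (k%:R / N%:R).
have F0 : F 0%N = a by rewrite /F mul0r mulr0 addr0.
have FN : F N = c by rewrite /F divff ?gt_eqF// mulr1 addrC subrK.
exists (map F (iota 1 N)); split.
- rewrite -F0; apply: path_iota => i _; rewrite /short_step /F -natr1 [(_ + 1) / _]mulrDl mul1r.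
  have : (c - a) * N%:R^-1 < d by rewrite mulrC -ltr_pdivlMr.
  have : 0 < (c - a) * N%:R^-1 by rewrite mulr_gt0// invr_gt0.
  by rewrite mulrDr; lra.
- by rewrite -F0 last_iota add0n.
- by rewrite -(prednK N0).
Qed.

Section partitions_of_one_path.
Variables (e d : R) (f : R -> X).
Hypothesis fd : forall x y, 0 <= x -> y <= 1 -> short_step d x y ->
  eps_close e (f x) (f y).

Lemma fine_path a l : 0 <= a -> last a l <= 1 -> path (short_step d) a l ->
  path (eps_close e) (f a) (map f l).
Proof.
elim: l a => //= c l IH a a0 l1 /andP[ac cl].
have /andP[_ c1] := fine_bounds cl (mem_head _ _).
rewrite fd//=; last exact: le_trans l1.
by apply: IH => //; apply: le_trans a0 _; case/andP: ac.
Qed.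

Lemma fine_echain a l : 0 <= a -> last a l <= 1 -> path (short_step d) a l ->
  echain e (f a) (f (last a l)) (map f l).
Proof. by move=> *; rewrite /echain last_map eqxx andbT; exact: fine_path. Qed.

Lemma fine_unique n a s w : (size s + size w <= n)%N ->
  0 <= a -> last a s <= 1 -> path (short_step d) a s -> path (short_step d) a w ->
  last a s = last a w ->
  ehomotopic e (f a) (f (last a s)) (map f s) (map f w).
Proof.
elim: n a s w => [|n IH] a s w.
  by case: s w => [|? ?] [|? ?] // *; exact: ehomotopic_refl.
have step c s' q w' : (size s' + (size w').+1 <= n)%N -> 0 <= a -> c <= q ->
    last c s' <= 1 ->
    path (short_step d) a (c :: s') -> path (short_step d) a (q :: w') ->
    last c s' = last q w' ->
    ehomotopic e (f a) (f (last c s')) (map f (c :: s')) (map f (q :: w')).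
  move=> sz a0 cq s1 sp wp swl.
  have /= /andP[/andP[ac acd] cs] := sp; have /= /andP[/andP[aq aqd] qw] := wp.
  have c0 : 0 <= c by exact: le_trans ac.
  have cqw : path (short_step d) c (q :: w').
    by rewrite /= qw andbT /short_step cq (lt_le_trans aqd)// lerD2r.
  have acqw : path (short_step d) a (c :: q :: w').
    by move: cqw; rewrite /= /short_step ac acd.
  apply: (@ehomotopic_trans _ _ _ _ _ (map f (c :: q :: w'))) => /=.
    apply: ehomotopic_cons; last by apply: (IH c s' (q :: w')).
    apply: fd => //; first by apply: le_trans s1; have /andP[] := fine_bounds cs (mem_head _ _).
    by rewrite /short_step ac.
  apply: ehomotopic_sym; rewrite swl in s1 *.
  apply: (@ehomotopic_insert _ _ _ _ _ [::] (map f (q :: w')) (f c)).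
  - exact: (@fine_echain a (q :: w') a0 s1 wp).
  - exact: (@fine_echain a [:: c, q & w'] a0 s1 acqw).
have step0 q w' : (size w' <= n)%N -> 0 <= a -> path (short_step d) a (q :: w') ->
    last q w' = a -> a <= 1 ->
    ehomotopic e (f a) (f a) [::] (map f (q :: w')).
  move=> sz a0 wp wl a1; have /= /andP[/andP[aq aqd] qw] := wp.
  have qa : q = a.
    have /andP[qa _] := fine_bounds qw (mem_head _ _).
    by apply/eqP; rewrite eq_le aq andbT -wl; have /andP[] := fine_bounds qw (mem_head _ _).
  subst q; apply: (@ehomotopic_trans _ _ _ _ _ (map f w')).
    by apply: (IH a [::] w').
  apply: (@ehomotopic_insert _ _ _ _ _ [::] (map f w') (f a)).
  - by rewrite -{2}wl; apply: fine_echain; rewrite ?wl.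
  - by have := @fine_echain a (a :: w') a0; rewrite /= wl => /(_ a1 wp).
case: s w => [|c s] [|q w] /=.
- by move=> *; exact: ehomotopic_refl.
- by rewrite add0n => sz a0 a1 _ wp wl; apply: step0 => //; rewrite -wl.
- rewrite addn0 => sz a0 a1 sp _ sl; rewrite sl in a1 *.
  by apply: ehomotopic_sym; exact: step0.
- rewrite addSn ltnS => sz a0 s1 sp wp sl.
  have [cq|/ltW qc] := leP c q; first exact: step.
  rewrite sl in s1 *; apply: ehomotopic_sym; apply: step => //.
  by rewrite addnC addSnnS.
Qed.

Lemma fan (x z : X) (l : seq X) : all (eps_close e x) (z :: l) ->
  path (eps_close e) z l ->
  ehomotopic e x (last z l) [:: last z l] (z :: l).
Proof.
elim: l z => [|y l IH] z /=; first by move=> *; exact: ehomotopic_refl.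
move=> /and3P[xz xy xl] /andP[zy yl].
apply: (ehomotopic_trans (IH y _ yl)); first by rewrite /= xy.
apply: (@ehomotopic_insert _ _ _ _ _ [::] (y :: l) z);
  by rewrite /echain /= ?xy ?xz ?zy yl eqxx.
Qed.

Lemma strong_fine a s : 0 < d -> 0 <= a -> last a s <= 1 ->
  path (strong_step e f) a s ->
  exists w, [/\ path (short_step d) a w, last a w = last a s &
    ehomotopic e (f a) (f (last a s)) (map f s) (map f w)].
Proof.
move=> d0; elim: s a => [|c s IH] a a0 /= s1.
  by move=> _; exists [::]; split => //; exact: ehomotopic_refl.
move=> /andP[/andP[ac /asboolP fac] cs].
have c0 : 0 <= c by exact: le_trans (ltW ac).
have [w [cw wl sw]] := IH c c0 s1 cs.
have [l [al lc]] := fine_subdivision d0 ac.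
case: l al lc => // z l al lc _; exists ((z :: l) ++ w); split.
- by rewrite cat_path lc al.
- by rewrite last_cat lc.
have c1 : c <= 1.
  by apply: le_trans s1; rewrite -wl; have /andP[] := fine_bounds cw (mem_head _ _).
have zl : path (eps_close e) (f a) (map f (z :: l)) by apply: fine_path => //; rewrite lc.
have /= /andP[_ zl'] := zl.
apply: (@ehomotopic_trans _ _ _ _ _ (map f (c :: w))) => /=.
  apply: ehomotopic_cons sw.
  by have [|] := fac c; rewrite ?lexx ?(ltW ac).
have lc' : last (f z) (map f l) = f c by rewrite last_map -lc.
rewrite map_cat -/([:: f c] ++ map f w) -/((f z :: map f l) ++ map f w).
apply: (@ehomotopic_catr _ _ _ _ (f c)).
  by rewrite -wl; apply: fine_echain; rewrite ?wl.
rewrite -lc'; apply: fan => //; apply/allP => y /(mapP (s := z :: l))[t tl ->].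
have [|//] := fac t; rewrite -[c in t <= c]lc.
by apply: (fine_bounds al); rewrite inE tl orbT.
Qed.

End partitions_of_one_path.

Lemma path_modulus e (f : R -> X) : 0 < e -> {within `[0, 1], continuous f} ->
  exists2 d, 0 < d &
    forall x y, 0 <= x -> y <= 1 -> short_step d x y -> eps_close e (f x) (f y).
Proof.
move=> e0 cf.
have [d d0 fd] := uniform_continuity (@segment_compact R 0 1) cf e0.
exists d => // x y x0 y1 /andP[xy yd]; apply: fd.
- by rewrite /= in_itv /= x0 (le_trans xy).
- by rewrite /= in_itv /= y1 (le_trans x0).
- by rewrite /ball /= distrC ger0_norm; lra.
Qed.

Lemma strong_partition_unique e (f : R -> X) s w :
  0 < e -> {within `[0, 1], continuous f} ->
  strong_partition e f s -> strong_partition e f w ->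
  ehomotopic e (f 0) (f 1) (map f s) (map f w).
Proof.
move=> e0 cf /strong_partitionP[sp s1] /strong_partitionP[wp w1].
have [d d0 fd] := path_modulus e0 cf.
have s1' : last 0 s <= 1 by rewrite s1.
have w1' : last 0 w <= 1 by rewrite w1.
have [s' [s'p s'1 ss']] := strong_fine fd d0 (lexx 0) s1' sp.
have [w' [w'p w'1 ww']] := strong_fine fd d0 (lexx 0) w1' wp.
rewrite s1 in s'1 ss'; rewrite w1 in w'1 ww'.
apply: (ehomotopic_trans ss'); apply: ehomotopic_trans (ehomotopic_sym ww').
have := fine_unique fd (leqnn (size s' + size w')) (lexx 0).
by rewrite s'1 w'1; apply.
Qed.

Lemma strong_echain e (f : R -> X) s :
  strong_partition e f s -> echain e (f 0) (f 1) (map f s).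
Proof.
move=> /strong_partitionP[sp s1]; rewrite /echain last_map s1 eqxx andbT.
rewrite path_map; apply: sub_path sp => x y /andP[xy /asboolP h].
by have [|] := h y; rewrite ?lexx ?(ltW xy).
Qed.

Definition regular_partition (N : nat) : seq R :=
  [seq k%:R / N%:R | k <- iota 1 N].

Lemma regular_partition_strong e d (f : R -> X) N : (0 < N)%N -> N%:R^-1 < d ->
  (forall x y, 0 <= x -> y <= 1 -> short_step d x y -> eps_close e (f x) (f y)) ->
  strong_partition e f (regular_partition N).
Proof.
move=> N0 Nd fd; have N0' : 0 < (N%:R : R) by rewrite ltr0n.
pose F k : R := k%:R / N%:R.
have F0 : F 0%N = 0 by rewrite /F mul0r.
have FN : F N = 1 by rewrite /F divff ?gt_eqF.
have FS k : F k.+1 = F k + N%:R^-1 by rewrite /F -natr1 mulrDl mul1r.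
have iN : 0 < (N%:R : R)^-1 by rewrite invr_gt0.
split; first split.
- by rewrite -F0; apply: path_iota => i _; rewrite -/(F i) -/(F i.+1) FS ltrDl.
- by rewrite -{1}F0 last_iota add0n -/(F N) FN.
have nthF i : (i <= N)%N -> nth 0 (0 :: regular_partition N) i = F i.
  case: i => [|i] iN' /=; first by rewrite F0.
  by rewrite (nth_map 0%N) ?size_iota// nth_iota// add1n.
move=> i; rewrite size_map size_iota => iltN.
rewrite !nthF// ?(ltnW iltN)//; move=> _ [t /= + <-].
rewrite in_itv /= => /andP[it ti].
have Fi : 0 <= F i by rewrite divr_ge0.
have F1 : F i.+1 <= 1 by rewrite ler_pdivrMr// mul1r ler_nat.
rewrite !ballEmdist /=; split.
- by apply: fd; rewrite // ?(le_trans ti)// /short_step it /=; move: ti; rewrite FS; lra.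
- rewrite metric_sym; apply: fd => //; first exact: le_trans it.
  by rewrite /short_step ti FS; lra.
Qed.

Lemma regular_partition_eventually e (f : R -> X) :
  0 < e -> {within `[0, 1], continuous f} ->
  exists2 M : nat, (0 < M)%N &
    forall N, (M <= N)%N -> strong_partition e f (regular_partition N).
Proof.
move=> e0 cf; have [d d0 fd] := path_modulus e0 cf.
have [M M0 Md] := inv_small d0; exists M => // N MN.
by apply: regular_partition_strong fd; [exact: leq_trans MN | exact: Md].
Qed.

Lemma ladder e (N : nat) (f g : nat -> X) : 0 < e ->
  (forall k, (k <= N)%N -> eps_close e (f k) (g k)) ->
  (forall k, (k < N)%N -> eps_close e (f k) (g k.+1)) ->
  (forall k, (k < N)%N -> eps_close e (f k) (f k.+1)) ->
  (forall k, (k < N)%N -> eps_close e (g k) (g k.+1)) ->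
  f 0%N = g 0%N -> f N = g N ->
  ehomotopic e (f 0%N) (f N) (map f (iota 1 N)) (map g (iota 1 N)).
Proof.
move=> e0 fg fgS ff gg fg0 fgN.
have gpath k n : (k + n)%N = N -> path (eps_close e) (g k) (map g (iota k.+1 n)).
  by move=> knN; apply: path_iota => i; rewrite knN => /andP[_ iN]; exact: gg.
have rung k n : (k + n)%N = N ->
    ehomotopic e (f k) (f N) (map f (iota k.+1 n)) (map g (iota k n.+1)).
  elim: n k => [|n IH] k knN.
    have -> : k = N by rewrite -knN addn0.
    rewrite /= -fgN; apply: (@ehomotopic_insert _ _ _ _ _ [::] [::] (f N));
      by rewrite /echain /= ?eps_close_refl ?eqxx.
  have kN : (k < N)%N by rewrite -knN addnS ltnS leq_addr.
  have knN' : (k.+1 + n)%N = N by rewrite addSnnS.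
  have gl : last (g k.+1) (map g (iota k.+2 n)) = f N by rewrite last_iota knN'.
  apply: (@ehomotopic_trans _ _ _ _ _ (map g (iota k.+1 n.+1))).
    apply: (ehomotopic_trans (ehomotopic_cons (ff _ kN) (IH _ knN'))).
    apply: ehomotopic_sym; apply: (@ehomotopic_insert _ _ _ _ _ [::] _ (f k.+1)).
      by rewrite /echain /= fgS// gpath//= gl.
    by rewrite /echain /= ff//= fg//= gpath//= gl.
  apply: (@ehomotopic_insert _ _ _ _ _ [::] (map g (iota k.+1 n.+1)) (g k)).
    by rewrite /echain /= fgS// gpath//= gl.
  by rewrite /echain /= fg ?(ltnW kN)//= gg//= gpath//= gl.
apply: (ehomotopic_trans (rung 0%N N (add0n N))); apply: ehomotopic_sym.
have gl : last (g 0%N) (map g (iota 1 N)) = f N by rewrite last_iota add0n.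
apply: (@ehomotopic_insert _ _ _ _ _ [::] (map g (iota 1 N)) (g 0%N)).
- by rewrite /echain fg0 gpath ?add0n//= gl.
- by rewrite /echain /= fg//= gpath ?add0n//= gl.
Qed.

Lemma homotopic_ehomotopic e (b : X) (f g : loop b) s w : 0 < e ->
  homotopic f g -> strong_partition e f s -> strong_partition e g w ->
  ehomotopic e b b (map f s) (map g w).
Proof.
move=> e0 /asboolP[H [cH H0 H1 Hs]] fs gw.
have [d d0 Hd] := uniform_continuity compact_unit_square cH e0.
have [Mf Mf0 fM] := regular_partition_eventually e0 (loop_continuous f).
have [Mg Mg0 gM] := regular_partition_eventually e0 (loop_continuous g).
have [Md Md0 dM] := inv_small d0.
pose N := maxn Md (maxn Mf Mg).
have {}dM : (N%:R : R)^-1 < d by apply: dM; rewrite /N; lia.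
have {}fM : strong_partition e f (regular_partition N) by apply: fM; rewrite /N; lia.
have {}gM : strong_partition e g (regular_partition N) by apply: gM; rewrite /N; lia.
have N0 : (0 < N)%N by rewrite /N; lia.
have N0' : 0 < (N%:R : R) by rewrite ltr0n.
have ends (h : loop b) u v : ehomotopic e (h 0) (h 1) u v -> ehomotopic e b b u v.
  by rewrite loop0 loop1.
apply: (@ehomotopic_trans _ _ _ _ _ (map f (regular_partition N))).
  by apply: (ends f); apply: strong_partition_unique => //; exact: loop_continuous.
apply: (@ehomotopic_trans _ _ _ _ _ (map g (regular_partition N))); last first.
  by apply: (ends g); apply: strong_partition_unique => //; exact: loop_continuous.
pose F k : R := k%:R / N%:R.
have F0 : F 0%N = 0 by rewrite /F mul0r.
have FN : F N = 1 by rewrite /F divff ?gt_eqF.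
have FS k : F k.+1 = F k + N%:R^-1 by rewrite /F -natr1 mulrDl mul1r.
have iN : 0 < (N%:R : R)^-1 by rewrite invr_gt0.
have F01 k : (k <= N)%N -> 0 <= F k <= 1.
  by move=> kN; rewrite divr_ge0//= ler_pdivrMr// mul1r ler_nat.
have near1 (x y : R) : x <= y <= x + N%:R^-1 -> ball x d y.
  by move=> xy; rewrite /ball /= distrC ger0_norm; lra.
have Hclose i j i' j' : (i' <= N)%N -> (j' <= N)%N -> (i <= i' <= i.+1)%N ->
    (j <= j' <= j.+1)%N -> eps_close e (H (F i, F j)) (H (F i', F j')).
  move=> iN' jN' /andP[ii i'i] /andP[jj j'j]; apply: Hd.
  - by rewrite unit_squareE !F01//; apply: leq_trans; eassumption.
  - by rewrite unit_squareE !F01.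
  - have near2 k k' : (k <= k')%N -> (k' <= k.+1)%N -> ball (F k) d (F k').
      move=> k1 k2; apply: near1; have : (k' == k) || (k' == k.+1) by lia.
      by case/orP => /eqP ->; rewrite ?FS; lra.
    by split; exact: near2.
pose row i := [seq H (F i, F k) | k <- iota 1 N].
have row0 : row 0%N = map f (regular_partition N).
  rewrite /row /regular_partition -map_comp; apply/eq_in_map => k /=.
  by rewrite mem_iota add1n ltnS => /andP[_ kN]; rewrite F0 H0//; exact: F01.
have rowN : row N = map g (regular_partition N).
  rewrite /row /regular_partition -map_comp; apply/eq_in_map => k /=.
  by rewrite mem_iota add1n ltnS => /andP[_ kN]; rewrite FN H1//; exact: F01.
rewrite -row0 -rowN.
have Hb i : (i <= N)%N -> H (F i, F 0%N) = b /\ H (F i, F N) = b.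
  by move=> iN'; rewrite F0 FN; apply: Hs; exact: F01.
suff rows i : (i <= N)%N -> ehomotopic e b b (row 0%N) (row i) by exact: rows.
elim: i => [|i IH] iN'; first by move=> *; exact: ehomotopic_refl.
apply: (ehomotopic_trans (IH (ltnW iN'))).
suff : ehomotopic e (H (F i, F 0%N)) (H (F i, F N)) (row i) (row i.+1).
  by rewrite (Hb i (ltnW iN')).1 (Hb i (ltnW iN')).2.
apply: (@ladder e N (fun k => H (F i, F k)) (fun k => H (F i.+1, F k))) => //.
- by move=> k kN; apply: Hclose => //; lia.
- by move=> k kN; apply: Hclose => //; lia.
- by move=> k kN; apply: Hclose => //; lia.
- by move=> k kN; apply: Hclose => //; lia.
- by rewrite (Hb i (ltnW iN')).1 (Hb i.+1 iN').1.
- by rewrite (Hb i (ltnW iN')).2 (Hb i.+1 iN').2.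
Qed.


Local Open Scope quotient_scope.
Variable b : X.
Implicit Types f g : loop b.

Lemma strong_partition_exists (e : {posnum R}) f :
  exists s, strong_partition e%:num f s.
Proof.
have [M _ H] := regular_partition_eventually [gt0 of e%:num] (loop_continuous f).
by exists (regular_partition M); exact: H.
Qed.

Lemma strong_eloop_subproof (e : {posnum R}) f s :
  strong_partition e%:num f s -> echain e%:num b b (map f s).
Proof. by move/strong_echain; rewrite loop0 loop1. Qed.

Definition strong_eloop (e : {posnum R}) f s (H : strong_partition e%:num f s) :
  eloop b e%:num := ELoop (strong_eloop_subproof H).

(* The strong chain is an arbitrary one along an arbitrary representative; by
   [h_epsE] every strong chain along every representative gives this class. *)
Definition h_eps (e : {posnum R}) (p : pi1 b) : pi_eps b e%:num :=
  \pi_(pi_eps b e%:num)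
    (strong_eloop (svalP (cid (strong_partition_exists e (repr p))))).

Lemma h_epsE (e : {posnum R}) f s (H : strong_partition e%:num f s) :
  h_eps e (\pi_(pi1 b) f) = \pi_(pi_eps b e%:num) (strong_eloop H).
Proof.
apply/pi_epsP/homotopic_ehomotopic => //; last exact: svalP.
by apply/pi1P; rewrite reprK.
Qed.

Lemma regular_partition_concat f g N : (0 < N)%N ->
  map (loop_concat f g) (regular_partition (N + N)) =
  map f (regular_partition N) ++ map g (regular_partition N).
Proof.
move=> N0; have N0' : 0 < (N%:R : R) by rewrite ltr0n.
rewrite /regular_partition iotaD !map_cat -!map_comp; congr (_ ++ _).
  apply/eq_in_map => k; rewrite mem_iota add1n ltnS /= => /andP[_ kN].
  have kN' : (k%:R : R) <= N%:R by rewrite ler_nat.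
  rewrite /concat natrD ifT; first by congr (f _); field; lra.
  by rewrite ler_pdivrMr; lra.
rewrite -[(1 + N)%N]addnC iotaDl -map_comp; apply/eq_in_map => k.
rewrite mem_iota add1n ltnS /= => /andP[k0 _].
have k0' : 0 < (k%:R : R) by rewrite ltr0n.
rewrite /concat !natrD ifN; first by congr (g _); field; lra.
by rewrite -ltNge ltr_pdivlMr; lra.
Qed.

Lemma h_epsM (e : {posnum R}) : {morph h_eps e : p q / (p * q)%g}.
Proof.
elim/quotW=> f; elim/quotW=> g.
have [Mf Mf0 fM] := regular_partition_eventually [gt0 of e%:num] (loop_continuous f).
have [Mg Mg0 gM] := regular_partition_eventually [gt0 of e%:num] (loop_continuous g).
have [Mc Mc0 cM] := regular_partition_eventually [gt0 of e%:num]
  (loop_continuous (loop_concat f g)).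
pose N := maxn Mc (maxn Mf Mg).
have fN : strong_partition e%:num f (regular_partition N) by apply: fM; rewrite /N; lia.
have gN : strong_partition e%:num g (regular_partition N) by apply: gM; rewrite /N; lia.
have cN : strong_partition e%:num (loop_concat f g) (regular_partition (N + N)).
  by apply: cM; rewrite /N; lia.
have -> : ((\pi f : pi1 b) * \pi g)%g = \pi_(pi1 b) (loop_concat f g).
  exact: pi1_mulE.
rewrite (h_epsE cN) (h_epsE fN) (h_epsE gN).
rewrite [RHS](pi_eps_mulE (strong_eloop fN) (strong_eloop gN)).
apply/pi_epsP => /=; rewrite regular_partition_concat; last by rewrite /N; lia.
exact: ehomotopic_refl.
Qed.

Lemma h_eps1 (e : {posnum R}) : h_eps e 1%g = 1%g.
Proof. by apply: (mulgI (h_eps e 1%g)); rewrite -h_epsM !mulg1. Qed.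

HB.instance Definition _ (e : {posnum R}) :=
  isMultiplicative.Build (pi1 b) (pi_eps b e%:num) (h_eps e) (h_epsM e).
HB.instance Definition _ (e : {posnum R}) :=
  Multiplicative_isUMagmaMorphism.Build (pi1 b) (pi_eps b e%:num) (h_eps e)
    (h_eps1 e).

Lemma h_epsV (e : {posnum R}) : {morph h_eps e : p / (p^-1)%g}.
Proof. exact: gmulfV. Qed.

End canonical_map.

#[short(type="groupTopologicalType")]
HB.structure Definition GroupTopological := {G of Group G & Topological G}.

Definition topological_group (G : groupTopologicalType) :=
  continuous (fun p : G * G => (p.1 * p.2)%g) /\
  continuous (fun x : G => (x^-1)%g).

Section covering_topology.
Context {R : realType} {X : metricType R}.
Variable b : X.
Implicit Types (g : pi1 b) (e : {posnum R}).

Definition K_eps e : set (pi1 b) := [set g | h_eps e g = 1%g].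

Definition pi_cl : set (pi1 b) := \bigcap_e K_eps e.

Lemma K_eps1 e : K_eps e 1%g.
Proof. exact: h_eps1. Qed.

Lemma K_epsM e x y : K_eps e x -> K_eps e y -> K_eps e (x * y)%g.
Proof. by rewrite /K_eps /= h_epsM => -> ->; rewrite mulg1. Qed.

Lemma K_epsV e x : K_eps e x -> K_eps e (x^-1)%g.
Proof. by rewrite /K_eps /= h_epsV => ->; rewrite invg1. Qed.

Lemma K_epsJ e x y : K_eps e x -> K_eps e (y^-1 * x * y)%g.
Proof. by rewrite /K_eps /= !h_epsM h_epsV => ->; rewrite mulg1 mulVg. Qed.

Lemma K_eps_le e1 e2 : e1%:num <= e2%:num -> K_eps e1 `<=` K_eps e2.
Proof.
move=> e12; elim/quotW=> f; rewrite /K_eps /=.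
have [M1 M10 fM1] := regular_partition_eventually [gt0 of e1%:num] (loop_continuous f).
have [M2 M20 fM2] := regular_partition_eventually [gt0 of e2%:num] (loop_continuous f).
have f1 := fM1 (maxn M1 M2) (leq_maxl _ _).
have f2 := fM2 (maxn M1 M2) (leq_maxr _ _).
rewrite (h_epsE f1) (h_epsE f2) => /pi_epsP f0; apply/pi_epsP.
exact: ehomotopic_le e12 f0.
Qed.

Definition pi1C := pi1 b.
HB.instance Definition _ := Group.on pi1C.

Definition covering_basis : set (set pi1C) :=
  [set A | exists g e, A = [set (g * k)%g | k in K_eps e]].

Lemma covering_basis_cover : \bigcup_(A in covering_basis) id A = setT.
Proof.
apply/seteqP; split => // g _.
exists [set (g * k)%g | k in K_eps 1%:pos]; first by exists g, 1%:pos.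
by exists 1%g; [exact: K_eps1 | rewrite mulg1].
Qed.

Lemma covering_basis_join (A B : set pi1C) (t : pi1C) :
  covering_basis A -> covering_basis B -> A t -> B t ->
  exists C, [/\ covering_basis C, C t & C `<=` A `&` B].
Proof.
move=> [g [e ->]] [g' [e' ->]] [k Kk <-] [k' Kk' kk'].
have e0 : 0 < Num.min e%:num e'%:num by rewrite lt_min !gt0.
exists [set (g * k * l)%g | l in K_eps (PosNum e0)]; split.
- by exists (g * k)%g, (PosNum e0).
- by exists 1%g; [exact: K_eps1 | rewrite mulg1].
- move=> _ [l Kl <-]; split.
    exists (k * l)%g; last by rewrite mulgA.
    by apply: K_epsM => //; apply: K_eps_le Kl; rewrite /= ge_min lexx.
  exists (k' * l)%g; last by rewrite mulgA kk'.
  by apply: K_epsM => //; apply: K_eps_le Kl; rewrite /= ge_min lexx orbT.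
Qed.

HB.instance Definition _ :=
  isBaseTopological.Build pi1C covering_basis_cover covering_basis_join.

(* Same left coset of [pi_cl]. *)
Definition pi_cl_eqv : rel pi1C := fun g h => `[< pi_cl (g^-1 * h)%g >].

Lemma pi_cl_eqv_refl : reflexive pi_cl_eqv.
Proof. by move=> g; apply/asboolP => e _; rewrite mulVg; exact: K_eps1. Qed.

Lemma pi_cl_eqv_trans : transitive pi_cl_eqv.
Proof.
move=> h g k /asboolP gh /asboolP hk; apply/asboolP => e _.
by rewrite -[X in (_ * X)%g](mulVKg h) mulgA; apply: K_epsM; [exact: gh|exact: hk].
Qed.

Lemma pi_cl_eqv_sym : symmetric pi_cl_eqv.
Proof.
suff H g h : pi_cl_eqv g h -> pi_cl_eqv h g by move=> g h; apply/idP/idP; exact: H.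
move=> /asboolP gh; apply/asboolP => e _.
by rewrite -[h in (_ * h)%g]invgK -invgM; apply: K_epsV; exact: gh.
Qed.

Canonical pi_cl_equiv :=
  EquivRel pi_cl_eqv pi_cl_eqv_refl pi_cl_eqv_sym pi_cl_eqv_trans.

Local Open Scope quotient_scope.

Definition pi1bar := quotient_topology {eq_quot pi_cl_equiv}.
HB.instance Definition _ := Quotient.on pi1bar.
HB.instance Definition _ := Topological.on pi1bar.

Definition pi1bar_one : pi1bar := \pi_pi1bar 1%g.
Definition pi1bar_mul (p q : pi1bar) : pi1bar := \pi_pi1bar (repr p * repr q)%g.
Definition pi1bar_inv (p : pi1bar) : pi1bar := \pi_pi1bar ((repr p)^-1)%g.

Lemma pi1barP (g h : pi1C) : \pi_pi1bar g = \pi_pi1bar h <-> pi_cl (g^-1 * h)%g.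
Proof.
split=> [/(@eqmodP _ pi_cl_equiv)/asboolP//|H].
exact/(@eqmodP _ pi_cl_equiv)/asboolP.
Qed.

Lemma pi1bar_mulE (g h : pi1C) :
  pi1bar_mul (\pi g) (\pi h) = \pi_pi1bar (g * h)%g.
Proof.
have /pi1barP gr := reprK (\pi_pi1bar g); have /pi1barP hr := reprK (\pi_pi1bar h).
set g' := repr _ in gr *; set h' := repr _ in hr *.
apply/pi1barP => e _.
have -> : ((g' * h')^-1 * (g * h) =
  (h'^-1 * h) * (h^-1 * (g'^-1 * g) * h))%g.
  by rewrite invgM !mulgA mulgK.
by apply: K_epsM; [exact: hr | apply: K_epsJ; exact: gr].
Qed.

Lemma pi1bar_invE (g : pi1C) : pi1bar_inv (\pi g) = \pi_pi1bar (g^-1)%g.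
Proof.
have /pi1barP gr := reprK (\pi_pi1bar g); set g' := repr _ in gr *.
apply/pi1barP => e _; rewrite invgK.
have -> : (g' * g^-1 = (g^-1)^-1 * (g'^-1 * g)^-1 * g^-1)%g.
  by rewrite invgM !invgK !mulgA mulgV mul1g.
by apply: K_epsJ; apply: K_epsV; exact: gr.
Qed.

Lemma pi1bar_mulA : associative pi1bar_mul.
Proof.
elim/quotW=> f; elim/quotW=> g; elim/quotW=> h.
rewrite (pi1bar_mulE g h) (pi1bar_mulE f (g * h)%g) (pi1bar_mulE f g).
by rewrite (pi1bar_mulE (f * g)%g h) mulgA.
Qed.

Lemma pi1bar_mul1 : left_id pi1bar_one pi1bar_mul.
Proof. by elim/quotW=> f; rewrite (pi1bar_mulE 1%g f) mul1g. Qed.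

Lemma pi1bar_1mul : right_id pi1bar_one pi1bar_mul.
Proof. by elim/quotW=> f; rewrite (pi1bar_mulE f 1%g) mulg1. Qed.

Lemma pi1bar_mulV : left_inverse pi1bar_one pi1bar_inv pi1bar_mul.
Proof.
by elim/quotW=> f; rewrite (pi1bar_invE f) (pi1bar_mulE f^-1%g f) mulVg.
Qed.

Lemma pi1bar_Vmul : right_inverse pi1bar_one pi1bar_inv pi1bar_mul.
Proof.
by elim/quotW=> f; rewrite (pi1bar_invE f) (pi1bar_mulE f f^-1%g) mulgV.
Qed.

HB.instance Definition _ := isGroup.Build pi1bar
  pi1bar_mulA pi1bar_mul1 pi1bar_1mul pi1bar_mulV pi1bar_Vmul.

End covering_topology.

(* Main.v *)
Require Import Defs.
From HB Require Import structures.
From mathcomp Require Import all_boot all_order all_algebra.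
From mathcomp Require Import all_classical reals topology normedtype.
From mathcomp Require Import interval_inference.

(** The subgroups [K_eps e] are normal and nested, and their cosets form a basis
    of the covering topology.  So this topology is given by the equivalence
    relations of lying in the same coset of [K_eps e], which the group
    operations respect.

    A coset of [K_eps e] is open, and its complement is a union of cosets of
    the same subgroup, so it is also closed.  Hence the component of [g] lies in
    the intersection over [e] of the cosets [g K_eps e], which is the coset of
    [g] modulo [pi_cl].  Conversely an open set containing a point contains
    its whole [pi_cl]-coset, so such a coset carries the indiscrete topology and
    is connected.  The components are therefore exactly the fibres of the
    projection to [pi1bar b], and this is the bijection ([componentE]).

    As open sets are unions of [pi_cl]-cosets, the projection is open, so a set is a
    neighbourhood of the class of [g] as soon as its preimage contains some
    [g K_eps e] ([nbhs_pi1bar]).  Continuity of the operations on [pi1bar b]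
    then reduces to normality of [K_eps e].  Two classes with no disjoint
    neighbourhoods lie in the same coset of every [K_eps e], hence agree modulo
    [pi_cl], which is separation. *)

Local Open Scope classical_set_scope.
Local Open Scope ring_scope.
Local Open Scope quotient_scope.

Section covering_topology.
Set Implicit Arguments.
Unset Strict Implicit.
Context {R : realType} {X : metricType R} {b : X}.
Implicit Types (e : {posnum R}) (g h k : pi1C b).

(** The coset [g K_eps e] in divided form, which makes it the class of [g] for
    an equivalence relation and compares directly with [pi1barP]. *)
Definition K_coset e g : set (pi1C b) := [set h | K_eps e (g^-1 * h)%g].

Lemma K_cosetE e g : K_coset e g = [set (g * k)%g | k in K_eps e].
Proof.
apply/seteqP; split => [h gh|_ [k Kk <-]]; last by rewrite /K_coset /= mulKg.
by exists (g^-1 * h)%g => //; rewrite mulVKg.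
Qed.

Lemma K_coset_refl e g : K_coset e g g.
Proof. by rewrite /K_coset /= mulVg; exact: K_eps1. Qed.

Lemma K_coset_sym e g h : K_coset e g h -> K_coset e h g.
Proof. by move/K_epsV; rewrite /K_coset /= invgM invgK. Qed.

Lemma K_coset_trans e g h k : K_coset e g h -> K_coset e h k -> K_coset e g k.
Proof. by move=> gh hk; have := K_epsM gh hk; rewrite mulgA mulgK. Qed.

(** Normality of [K_eps e] makes the coset relation a congruence. *)
Lemma K_cosetM e g g' h h' :
  K_coset e g g' -> K_coset e h h' -> K_coset e (g * h)%g (g' * h')%g.
Proof.
move=> gg' hh'; have := K_epsM (K_epsJ h gg') hh'.
by rewrite /K_coset /= invgM !mulgA mulgK.
Qed.

Lemma K_cosetV e g g' : K_coset e g g' -> K_coset e (g^-1)%g (g'^-1)%g.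
Proof.
move=> /K_epsV/(K_epsJ (g^-1)%g).
by rewrite /K_coset /= invgM !invgK !mulgA mulgK.
Qed.

Lemma open_K_coset e g : open (K_coset e g).
Proof.
exists [set K_coset e g]; last by rewrite bigcup_set1.
by move=> _ ->; exists g, e; exact: K_cosetE.
Qed.

Lemma nbhs_pi1C g (U : set (pi1C b)) :
  nbhs g U <-> exists e, K_coset e g `<=` U.
Proof.
split=> [|[e eU]]; last first.
  apply: filterS eU _; apply: open_nbhs_nbhs.
  by split; [exact: open_K_coset | exact: K_coset_refl].
rewrite nbhsE => -[V [[D bD <-] [A DA Ag]] VU].
have [h [e Ahe]] := bD _ DA; exists e => k gk; apply: VU; exists A => //.
by move: Ag; rewrite Ahe -K_cosetE => hg; exact: K_coset_trans hg gk.
Qed.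

Lemma closed_K_coset e g : closed (K_coset e g).
Proof.
rewrite -[K_coset e g]setCK; apply: open_closedC.
rewrite openE => h gh; apply/nbhs_pi1C; exists e => k hk gk.
by apply: gh; apply: K_coset_trans gk _; exact: K_coset_sym.
Qed.

Lemma pi_clP g h : pi_cl (g^-1 * h)%g <-> forall e, K_coset e g h.
Proof. by split=> [gh e|gh e _]; exact: gh. Qed.

(** Points congruent modulo [pi_cl] share all their basic neighbourhoods. *)
Lemma open_pi_cl (U : set (pi1C b)) g h :
  open U -> pi_cl (g^-1 * h)%g -> U g -> U h.
Proof.
by rewrite openE => oU /pi_clP gh /oU/nbhs_pi1C[e]; apply.
Qed.

(** The trace of an open set on a [pi_cl]-coset is empty or everything. *)
Lemma connected_pi_cl g : connected [set h : pi1C b | pi_cl (g^-1 * h)%g].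
Proof.
move=> B [x Bx] [C oC BE] _; rewrite BE in Bx *.
apply/seteqP; split => [h []//|h gh]; split=> //; case: Bx => /pi_clP gx Cx.
move/pi_clP: gh => gh; apply: open_pi_cl oC _ Cx; apply/pi_clP => e.
exact: K_coset_trans (K_coset_sym (gx e)) (gh e).
Qed.

Lemma componentE g :
  connected_component [set: pi1C b] g = [set h | pi_cl (g^-1 * h)%g].
Proof.
apply/seteqP; split; last first.
  apply: connected_component_max => //; last exact: connected_pi_cl.
  by apply/pi_clP => e; exact: K_coset_refl.
move=> h [A [Ag _ cA] Ah]; apply/pi_clP => e.
(* [K_coset e g] is clopen and meets the connected set [A] at [g]. *)
suff : A `&` K_coset e g = A by move=> /[dup] AE; rewrite -AE in Ah; case: Ah.
apply: cA.
- by exists g; split=> //; exact: K_coset_refl.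
- by exists (K_coset e g) => //; exact: open_K_coset.
- by exists (K_coset e g) => //; exact: closed_K_coset.
Qed.

(** The open set [g K_eps e] is a union of [pi_cl]-cosets, so it is the
    preimage of its image, which is therefore open in the quotient. *)
Lemma nbhs_pi1bar g (U : set (pi1bar b)) :
  nbhs (\pi_(pi1bar b) g) U <->
  exists e, K_coset e g `<=` \pi_(pi1bar b) @^-1` U.
Proof.
split=> [gU|[e eU]].
  by apply/nbhs_pi1C; exact: (@pi_continuous _ (pi1bar b) g _ gU).
rewrite nbhsE; exists (\pi_(pi1bar b) @` K_coset e g); last first.
  by move=> _ [h gh <-]; exact: eU.
split; last by exists g => //; exact: K_coset_refl.
suff oK : open (\pi_(pi1bar b) @^-1` (\pi_(pi1bar b) @` K_coset e g)) by [].
rewrite [X in open X](_ : _ = K_coset e g); first exact: open_K_coset.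
apply/seteqP; split=> [h /= [k gk /pi1barP/pi_clP kh]|h gh]; last by exists h.
exact: K_coset_trans gk (kh e).
Qed.

Lemma pi1bar_topological_group : topological_group (pi1bar b).
Proof.
split.
- move=> [p q] U /=; elim/quotW: p => g; elim/quotW: q => h.
  rewrite [X in nbhs X U](_ : _ = \pi_(pi1bar b) (g * h)%g); last first.
    exact: pi1bar_mulE.
  move=> /nbhs_pi1bar[e eU].
  exists (\pi_(pi1bar b) @` K_coset e g, \pi_(pi1bar b) @` K_coset e h).
    by split; apply/nbhs_pi1bar; exists e => k ek; exists k.
  move=> [_ _] [/= [g' gg' <-] [h' hh' <-]].
  rewrite /= [X in U X](_ : _ = \pi_(pi1bar b) (g' * h')%g); last first.
    exact: pi1bar_mulE.
  exact/eU/K_cosetM.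
- move=> p U; elim/quotW: p => g.
  rewrite [X in nbhs X U](_ : _ = \pi_(pi1bar b) (g^-1)%g); last exact: pi1bar_invE.
  move=> /nbhs_pi1bar[e eU]; apply/nbhs_pi1bar; exists e => h gh /=.
  rewrite [X in U X](_ : _ = \pi_(pi1bar b) (h^-1)%g); last exact: pi1bar_invE.
  exact/eU/K_cosetV.
Qed.

Lemma pi1bar_hausdorff : hausdorff_space (pi1bar b).
Proof.
move=> p q; elim/quotW: p => g; elim/quotW: q => h clgh.
apply/pi1barP/pi_clP => e.
have nb k : nbhs (\pi_(pi1bar b) k) (\pi_(pi1bar b) @` K_coset e k).
  by apply/nbhs_pi1bar; exists e => l; exists l.
have [_ [[k gk <-] [l hl /esym/pi1barP/pi_clP kl]]] := clgh _ _ (nb g) (nb h).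
by apply: K_coset_trans gk (K_coset_trans (kl e) _); exact: K_coset_sym.
Qed.

Lemma pi1bar_component_bij :
  exists F : pi1bar b -> set (pi1C b),
    set_bij [set: pi1bar b]
      [set connected_component [set: pi1C b] g | g in [set: pi1C b]] F /\
    forall g, F (\pi_(pi1bar b) g) = connected_component [set: pi1C b] g.
Proof.
pose F (p : pi1bar b) : set (pi1C b) := [set h | \pi_(pi1bar b) h = p].
have FE g : F (\pi_(pi1bar b) g) = connected_component [set: pi1C b] g.
  by rewrite componentE; apply/seteqP; split=> h; [move/esym/pi1barP|move=> /pi1barP ->].
exists F; split=> //; split.
- by elim/quotW=> g _; rewrite FE; exists g.
- elim/quotW=> g; elim/quotW=> h _ _ Fgh.
  by have : F (\pi_(pi1bar b) g) g by []; rewrite Fgh.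
- by move=> _ [g _ <-]; exists (\pi_(pi1bar b) g).
Qed.

End covering_topology.

Theorem lemma5p7 (R : realType) (X : metricType R) (b : X) :
  geodesic X -> compact [set: X] ->
  [/\ topological_group (pi1bar b),
      hausdorff_space (pi1bar b) &
      exists F : pi1bar b -> set (pi1C b),
        set_bij [set: pi1bar b]
          [set connected_component [set: pi1C b] g | g in [set: pi1C b]] F /\
        forall g : pi1C b,
          F (\pi_(pi1bar b) g) = connected_component [set: pi1C b] g].
Proof.
move=> _ _; split.
- exact: pi1bar_topological_group.
- exact: pi1bar_hausdorff.
- exact: pi1bar_component_bij.
Qed.
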